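(* Let $p\ge3$ be an integer and let $Q$ be any convex, non-degenerate quadrilateral. Then $\mathbb P^p\subset P^p_Q$, i.e. (the restriction to $\overline Q$ of) every bivariate polynomial of total degree at most $p$ belongs to $P^p_Q$.
   Context: **Quadrilateral.** $Q\subset\mathbb R^2$ is an open, convex, non-degenerate quadrilateral with vertices $\mathbf v_1,\dots,\mathbf v_4$ in counter-clockwise order and open edges $\varepsilon_i$ joining $\mathbf v_i$ and $\mathbf v_{i+1}$ (indices modulo 4). Let $\hat Q=[0,1]^2$ and let $\mathbf F_Q:\hat Q\to\overline Q$ be the bilinear parametrization $$\mathbf F_Q(\xi_1,\xi_2)=(1-\xi_1)(1-\xi_2)\mathbf v_1+\xi_1(1-\xi_2)\mathbf v_2+\xi_1\xi_2\mathbf v_3+(1-\xi_1)\xi_2\mathbf v_4 .$$ Put $\hat\varepsilon_i=\mathbf F_Q^{-1}(\varepsilon_i)$; $\mathbf n_{\varepsilon_i}$ is a fixed unit normal to $\varepsilon_i$ and $\partial_{\mathbf n_{\varepsilon_i}}$ the derivative in that direction. **Polynomials.** $\mathbb P^{(p,p)}$: bivariate polynomials of bi-degree $(p,p)$. $\mathbb P^p$: univariate or bivariate polynomials of total degree at most $p$, depending on context. **Local space $P^p_Q$.** For $p\ge5$: all $\varphi:\overline Q\to\mathbb R$ with $\varphi\circ\mathbf F_Q\in\mathbb P^{(p,p)}$ and $(\partial_{\mathbf n_{\varepsilon_i}}\varphi\circ\mathbf F_Q)|_{\hat\varepsilon_i}\in\mathbb P^{p-1}$ for $i=1,\dots,4$.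 For $p\in\{3,4\}$: let $k=6-p$ and $s_k(\hat Q)=\{[\frac ik,\frac{i+1}k]\times[\frac jk,\frac{j+1}k]:0\le i,j\le k-1\}$; then $P^p_Q$ consists of all $\varphi:\overline Q\to\mathbb R$ with $\varphi\in C^{p-2}(Q)$, $(\varphi\circ\mathbf F_Q)|_{\hat q}\in\mathbb P^{(p,p)}$ for all $\hat q\in s_k(\hat Q)$, $(\varphi\circ\mathbf F_Q)|_{\hat\varepsilon_i}\in C^{p-1}(\hat\varepsilon_i)$ for all $i$, and $(\partial_{\mathbf n_{\varepsilon_i}}\varphi\circ\mathbf F_Q)|_{\hat\varepsilon_i\cap\hat q}\in\mathbb P^{p-1}$ for all $i$ and all $\hat q\in s_k(\hat Q)$. *)

(* Defs.v *)
From HB Require Import structures.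
From mathcomp Require Import all_boot all_order all_algebra.
From mathcomp Require Import all_classical all_reals all_analysis.

Set Implicit Arguments.
Unset Strict Implicit.
Unset Printing Implicit Defensive.

Import Order.TTheory GRing.Theory Num.Theory.
Import numFieldNormedType.Exports.

Local Open Scope classical_set_scope.
Local Open Scope ring_scope.

(* Points of the plane are row vectors; [x 0 0] and [x 0 1] are the two
   coordinates.  The vertices are indexed from 0 by 'I_4, and [i + 1] is
   addition modulo 4.

   A function on the closure of Q is represented by a total function on the
   plane; the sets of functions below constrain its values on the closure of Q
   only. *)

Section Regularity.
Variables (R : realType) (V : normedModType R).

(* Functions of class C^m on the open set U; in finite dimension, continuity
   of the differential of f amounts to that of all the derivatives 'D_u f. *)
Fixpoint Cm (m : nat) (U : set V) (f : V -> R^o) : Prop :=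
  match m with
  | 0%N => forall x, U x -> {for x, continuous f}
  | m'.+1 => (forall x, U x -> differentiable f x) /\
             (forall u : V, Cm m' U ('D_u f))
  end.

End Regularity.

Section Polynomials.
Variable R : realType.

(* [P`_i`_j] is the coefficient of x_1^i x_2^j in [P.[x_1, x_2]]. *)

Definition bidegree_le (p : nat) (P : {poly {poly R}}) : Prop :=
  (size P <= p.+1)%N /\ (sizeY P <= p.+1)%N.

Definition total_degree_le (p : nat) (P : {poly {poly R}}) : Prop :=
  forall i j : nat, P`_i`_j != 0 -> (i + j <= p)%N.

End Polynomials.

Section Quadrilateral.
Variable R : realType.
Implicit Types (v n : 'I_4 -> 'rV[R]_2) (x xi : 'rV[R]_2) (phi : 'rV[R]_2 -> R).

(* Twice the signed area of the triangle a, b, c: it is positive iff c lies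
   strictly to the left of the line from a to b. *)
Definition orient (a b c : 'rV[R]_2) : R :=
  (b 0 0 - a 0 0) * (c 0 1 - a 0 1) - (b 0 1 - a 0 1) * (c 0 0 - a 0 0).

(* The [v i] are the vertices, in counter-clockwise order, of a convex
   quadrilateral without three collinear vertices. *)
Definition convex_quad v : Prop :=
  forall i j : 'I_4, j != i -> j != i + 1 -> 0 < orient (v i) (v (i + 1)) (v j).

Definition vertex_hull v : set 'rV[R]_2 :=
  [set x | exists2 c : 'I_4 -> R, (forall i, 0 <= c i) /\ \sum_i c i = 1
                                & x = \sum_i c i *: v i].

Definition quad v : set 'rV[R]_2 := interior (vertex_hull v).

Definition edge v (i : 'I_4) : set 'rV[R]_2 :=
  [set x | exists2 t : R, 0 < t < 1 & x = (1 - t) *: v i + t *: v (i + 1)].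

Definition unit_normal v (i : 'I_4) (m : 'rV[R]_2) : Prop :=
  m 0 0 ^+ 2 + m 0 1 ^+ 2 = 1 /\
  m 0 0 * (v (i + 1) 0 0 - v i 0 0) + m 0 1 * (v (i + 1) 0 1 - v i 0 1) = 0.

Definition hatQ : set 'rV[R]_2 := [set xi | forall j, 0 <= xi 0 j <= 1].

Definition FQ v xi : 'rV[R]_2 :=
  ((1 - xi 0 0) * (1 - xi 0 1)) *: v 0 + (xi 0 0 * (1 - xi 0 1)) *: v 1
  + (xi 0 0 * xi 0 1) *: v 2 + ((1 - xi 0 0) * xi 0 1) *: v 3.

Definition hat_edge v (i : 'I_4) : set 'rV[R]_2 :=
  hatQ `&` FQ v @^-1` edge v i.

(* The coordinate along [hat_edge v i]: the edges 0 and 2 of the unit square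
   are parallel to the first axis, 1 and 3 to the second; it maps each of them
   onto ]0, 1[. *)
Definition edge_coord (i : 'I_4) xi : R := if odd i then xi 0 1 else xi 0 0.

(* [i/k, (i+1)/k] x [j/k, (j+1)/k], an element of the uniform k x k partition of
   the unit square. *)
Definition subsquare (k : nat) (i j : 'I_k) : set 'rV[R]_2 :=
  [set xi | i%:R / k%:R <= xi 0 0 <= i.+1%:R / k%:R /\
            j%:R / k%:R <= xi 0 1 <= j.+1%:R / k%:R].

(* The derivative at x in the direction m of a function phi defined on the
   closure of Q only; on an edge of Q, with m normal to it, the limit is
   one-sided. *)
Definition is_derive_in v phi (m x : 'rV[R]_2) (l : R) : Prop :=
  t^-1 * (phi (x + t *: m) - phi x)
    @[t --> within [set t | closure (quad v) (x + t *: m)] 0^'] --> l.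

Definition pullback_poly v (p : nat) phi (A : set 'rV[R]_2) : Prop :=
  exists2 P : {poly {poly R}}, bidegree_le p P &
    forall xi, A xi -> phi (FQ v xi) = P.[xi 0 0, xi 0 1].

(* On A, a subset of [hat_edge v i], the derivative of phi along m composed
   with FQ is a univariate polynomial of degree at most d. *)
Definition normal_derive_poly v (d : nat) phi (i : 'I_4) (m : 'rV[R]_2)
    (A : set 'rV[R]_2) : Prop :=
  exists2 q : {poly R}, (size q <= d.+1)%N &
    forall xi, A xi -> is_derive_in v phi m (FQ v xi) q.[edge_coord i xi].

Definition pullback_edge_Cm v (m : nat) phi (i : 'I_4) : Prop :=
  exists2 g : R^o -> R^o, Cm m [set s : R^o | 0 < s < 1] g &
    forall xi, hat_edge v i xi -> phi (FQ v xi) = g (edge_coord i xi).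

Definition local_space_poly (p : nat) v n : set ('rV[R]_2 -> R) :=
  [set phi | pullback_poly v p phi hatQ /\
             forall i, normal_derive_poly v p.-1 phi i (n i) (hat_edge v i)].

Definition local_space_spline (p k : nat) v n : set ('rV[R]_2 -> R) :=
  [set phi | [/\ Cm (p - 2) (quad v) phi,
     forall a b : 'I_k, pullback_poly v p phi (subsquare a b),
     forall i, pullback_edge_Cm v p.-1 phi i &
     forall i (a b : 'I_k), normal_derive_poly v p.-1 phi i (n i)
                              (hat_edge v i `&` subsquare a b)]].

(* Meaningful for p >= 3. *)
Definition local_space (p : nat) v n : set ('rV[R]_2 -> R) :=
  if (5 <= p)%N then local_space_poly p v n
  else local_space_spline p (6 - p) v n.

Definition poly_space (p : nat) (A : set 'rV[R]_2) : set ('rV[R]_2 -> R) :=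
  [set phi | exists2 P : {poly {poly R}}, total_degree_le p P &
               forall x, A x -> phi x = P.[x 0 0, x 0 1]].

End Quadrilateral.

(* Main.v *)
From HB Require Import structures.
Require Import Defs.
From mathcomp Require Import all_boot all_order all_algebra.
From mathcomp Require Import all_classical all_reals all_analysis.
From mathcomp Require Import ring lra zify.
Set Implicit Arguments.
Unset Strict Implicit.
Unset Printing Implicit Defensive.
Import Order.TTheory GRing.Theory Num.Theory.
Import numFieldNormedType.Exports.
Local Open Scope classical_set_scope.
Local Open Scope ring_scope.

(** Let phi be a polynomial P of total degree at most p on the closure of Q.
    On the unit square, phi o F_Q is the composition of P with the two bilinear
    components of F_Q.  Each component has degree at most 1 in either variable,
    so each monomial x^i y^j with i + j <= p is turned into a polynomial of
    degree at most i + j <= p in either variable: this is the bi-degree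
    condition.

    On an edge, F_Q is affine in the coordinate s along the edge, say
    (1 - s) a + s b.  For a vector m, the polynomial
    T(t, s) = P((1 - s) a + s b + t m) has total degree at most p, and its
    coefficient of t^1 is the derivative of P in the direction m along the
    edge.  As t has already used one degree, this coefficient is a polynomial
    of degree at most p - 1 in s: this is the normal derivative condition.

    Both degree bounds are instances of one fact about weighted degrees,
    [wdeg_le_subst2], with the weights (1, 0), (0, 1) for the bi-degree and
    (1, 1) for the total degree.

    For p = 3, 4 the conditions on the subsquares are restrictions of those on
    the whole square, and the smoothness conditions hold because polynomial
    functions are of class C^m for all m ([polyfun_Cm]).

    Two geometric facts carry P over from the closure of Q to the unit square.
    The map F_Q sends the square into the convex hull of the vertices, which
    lies in the closure of its own interior Q
    ([vertex_hull_sub_closure_quad]); and only points of the i-th side of the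
    square are sent to the i-th edge ([hat_edge_affine]). *)

(** * Weighted degrees of bivariate polynomials *)

Section WeightedDegree.
Variable R : realType.
Implicit Types P Q X Y : {poly {poly R}}.

(** The variable of the outer polynomials has weight [a], that of the
    coefficients has weight [b]. *)
Definition wdeg_le (a b d : nat) P : Prop :=
  forall i j : nat, P`_i`_j != 0 -> (a * i + b * j <= d)%N.

Lemma wdeg_leW a b d d' P :
  (d <= d')%N -> wdeg_le a b d P -> wdeg_le a b d' P.
Proof. by move=> dd' dP i j /dP /leq_trans; apply. Qed.

Lemma wdeg_leD a b d P Q :
  wdeg_le a b d P -> wdeg_le a b d Q -> wdeg_le a b d (P + Q).
Proof.
move=> dP dQ i j; rewrite !coefD.
have [->|/dP//] := eqVneq (P`_i`_j) 0.
by rewrite add0r => /dQ.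
Qed.

Lemma wdeg_leN a b d P : wdeg_le a b d P -> wdeg_le a b d (- P).
Proof. by move=> dP i j; rewrite !coefN oppr_eq0 => /dP. Qed.

Lemma wdeg_le0 a b d : wdeg_le a b d 0.
Proof. by move=> i j; rewrite !coef0 eqxx. Qed.

Lemma wdeg_leC a b c : wdeg_le a b 0 c%:P%:P.
Proof.
move=> i j; rewrite coefC.
case: i => [|i] /=; last by rewrite coef0 eqxx.
by rewrite coefC; case: j => [|j] /=; rewrite ?eqxx // !muln0.
Qed.

Lemma wdeg_leX a b : wdeg_le a b a 'X.
Proof.
move=> i j; rewrite coefX.
have [->|_] := eqVneq i 1%N; last by rewrite coef0 eqxx.
by rewrite coef1; case: j => [|j]; rewrite ?eqxx // muln1 muln0 addn0.
Qed.

Lemma wdeg_leY a b : wdeg_le a b b 'X%:P.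
Proof.
move=> i j; rewrite coefC; case: i => [|i] /=; last by rewrite coef0 eqxx.
rewrite coefX; have [->|_] := eqVneq j 1%N; last by rewrite eqxx.
by rewrite muln0 muln1.
Qed.

(** A coefficient of [P * Q] is a sum of products of coefficients of [P] and
    [Q] whose indices add up to its own, and the weight is additive. *)
Lemma wdeg_leM a b d e P Q :
  wdeg_le a b d P -> wdeg_le a b e Q -> wdeg_le a b (d + e) (P * Q).
Proof.
move=> dP dQ i j; apply: contraR; rewrite -ltnNge => lt_de.
rewrite coefM coef_sum big1 // => k _; rewrite coefM big1 // => l _.
have [->|/dP Pkl] := eqVneq (P`_k`_l) 0; first by rewrite mul0r.
have [->|/dQ Qkl] := eqVneq (Q`_(i - k)`_(j - l)) 0; first by rewrite mulr0.
have := ltn_ord k; have := ltn_ord l; nia.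
Qed.

Lemma wdeg_leXn a b d n P : wdeg_le a b d P -> wdeg_le a b (n * d) (P ^+ n).
Proof.
move=> dP; elim: n => [|n IHn]; first by rewrite expr0; exact: wdeg_leC.
by rewrite exprS mulSn; exact: wdeg_leM.
Qed.

Lemma wdeg_le_sum a b d (I : Type) (r : seq I) (F : I -> {poly {poly R}}) :
  (forall i, wdeg_le a b d (F i)) -> wdeg_le a b d (\sum_(i <- r) F i).
Proof.
move=> dF; apply: big_ind => //; [exact: wdeg_le0|exact: wdeg_leD].
Qed.

(** The composition P(X, Y), written as a sum over the monomials of [P] so that
    its degrees can be bounded term by term. *)
Definition subst2 P X Y : {poly {poly R}} :=
  \sum_(i < size P) \sum_(j < size P`_i) (P`_i`_j)%:P%:P * (X ^+ i * Y ^+ j).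

Lemma horner_subst2 P X Y (x y : R) :
  (subst2 P X Y).[x%:P].[y] = P.[X.[x%:P].[y]%:P].[Y.[x%:P].[y]].
Proof.
rewrite (horner_coef P) !horner_sum.
apply: eq_bigr => i _; rewrite !horner_sum hornerM (horner_coef P`_i) mulr_suml.
apply: eq_bigr => j _.
by rewrite !hornerE /= mulrAC.
Qed.

(** A monomial of [P] of exponents [i], [j] becomes [X ^+ i * Y ^+ j], of
    weighted degree at most [(i + j) * d]; the bound on the total degree of [P]
    then gives [p * d]. *)
Lemma wdeg_le_subst2 a b d p P X Y :
  total_degree_le p P -> wdeg_le a b d X -> wdeg_le a b d Y ->
  wdeg_le a b (p * d) (subst2 P X Y).
Proof.
move=> dP dX dY; apply: wdeg_le_sum => i; apply: wdeg_le_sum => j.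
have [->|/dP ij_p] := eqVneq (P`_i`_j) 0.
  by rewrite !polyC0 mul0r; exact: wdeg_le0.
apply: (@wdeg_leW _ _ (0 + (i * d + j * d))); last first.
  apply: wdeg_leM; first exact: wdeg_leC.
  by apply: wdeg_leM; exact: wdeg_leXn.
by rewrite -mulnDl leq_mul2r ij_p orbT.
Qed.

Lemma wdeg_le_bidegree p P :
  wdeg_le 1 0 p P -> wdeg_le 0 1 p P -> bidegree_le p P.
Proof.
move=> dX dY; split.
  apply/leq_sizeP => i lt_pi; apply/polyP => j; rewrite coef0.
  apply/eqP; apply: contraLR lt_pi => /dX; lia.
rewrite /sizeY; apply/bigmax_leqP => i _; apply/leq_sizeP => j lt_pj.
by apply/eqP; apply: contraLR lt_pj => /dY; lia.
Qed.

End WeightedDegree.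

(** * Smoothness of polynomial functions *)

Section PolynomialFunctions.
Variables (R : realType) (V : normedModType R).

(** The algebra generated by the continuous linear forms.  It is stable under
    all directional derivatives and does not depend on coordinates, so that it
    serves for functions on the plane as well as on the line. *)
Inductive polyfun : (V -> R^o) -> Prop :=
| polyfun_cst (c : R) : polyfun (fun=> c)
| polyfun_lin (f : {linear V -> R^o}) : continuous f -> polyfun f
| polyfunD f g : polyfun f -> polyfun g -> polyfun (fun x => f x + g x)
| polyfunM f g : polyfun f -> polyfun g -> polyfun (fun x => f x * g x).

Lemma polyfun_differentiable f : polyfun f -> forall x, differentiable f x.
Proof.
elim=> {f} [c|f cf|f g _ df _ dg|f g _ df _ dg] x.
- exact: differentiable_cst.
- exact: linear_differentiable.
- exact: differentiableD.
- exact: differentiableM.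
Qed.

Lemma polyfun_derive f : polyfun f -> forall u, polyfun ('D_u f).
Proof.
elim=> {f} [c|f cf|f g pf df pg dg|f g pf df pg dg] u.
- have -> : 'D_u (fun=> c) = (fun=> 0) :> (V -> R^o).
    by apply/funext => x; rewrite (derive_cst (c : R^o)).
  exact: polyfun_cst.
- have -> : 'D_u f = (fun=> f u) :> (V -> R^o).
    apply/funext => x; rewrite deriveE ?diff_lin//.
    exact: linear_differentiable.
  exact: polyfun_cst.
- have -> : 'D_u (fun x => f x + g x) = (fun x => 'D_u f x + 'D_u g x).
    apply/funext => x; apply: deriveD; apply: diff_derivable;
    exact: polyfun_differentiable.
  by apply: polyfunD.
- have -> : 'D_u (fun x => f x * g x) =
            (fun x => f x * 'D_u g x + g x * 'D_u f x).
    apply/funext => x; apply: deriveM; apply: diff_derivable;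
    exact: polyfun_differentiable.
  by apply: polyfunD; apply: polyfunM.
Qed.

Lemma polyfun_Cm m (U : set V) f : polyfun f -> Cm m U f.
Proof.
elim: m f => [|m IHm] f pf /=.
  move=> x _; exact/differentiable_continuous/polyfun_differentiable.
split=> [x _|u]; first exact: polyfun_differentiable.
exact/IHm/polyfun_derive.
Qed.

Lemma polyfun_horner (p : {poly R}) f : polyfun f -> polyfun (fun x => p.[f x]).
Proof.
move=> pf; elim/poly_ind: p => [|p c IHp].
  have -> : (fun x => 0.[f x]) = (fun=> 0) :> (V -> R^o).
    by apply/funext => x; rewrite horner0.
  exact: polyfun_cst.
have -> : (fun x => (p * 'X + c%:P).[f x]) = (fun x => p.[f x] * f x + c).
  by apply/funext => x; rewrite !hornerE.
by apply: polyfunD; [exact: polyfunM|exact: polyfun_cst].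
Qed.

Lemma polyfun_horner2 (P : {poly {poly R}}) f g :
  polyfun f -> polyfun g -> polyfun (fun x => P.[(f x)%:P].[g x]).
Proof.
move=> pf pg; elim/poly_ind: P => [|P c IHP].
  have -> : (fun x => 0.[(f x)%:P].[g x]) = (fun=> 0) :> (V -> R^o).
    by apply/funext => x; rewrite !horner0.
  exact: polyfun_cst.
have -> : (fun x => (P * 'X + c%:P).[(f x)%:P].[g x]) =
          (fun x => P.[(f x)%:P].[g x] * f x + c.[g x]).
  by apply/funext => x; rewrite !hornerE.
by apply: polyfunD; [exact: polyfunM|exact: polyfun_horner].
Qed.

(** The expansions of [f] and [g] at [x] coincide near [x], hence the
    differential of [g] at [x] is also one of [f]. *)
Lemma near_eq_differentiable (f g : V -> R^o) x :
  (\near x, f x = g x) -> differentiable g x -> differentiable f x.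
Proof.
move=> fg dg.
have [cdg /eqaddoP Dg] := (diff_locallyP x g).1 dg.
have fgx : f x = g x := nbhs_singleton fg.
have Df : f \o shift x = cst (f x) + 'd g x +o_ (0 : V) id.
  apply/eqaddoP => e e0; have := Dg e e0.
  have fg0 : \forall z \near (0 : V), f (z + x) = g (z + x).
    by rewrite (near_shift 0) /= subr0 in fg.
  by apply: filterS2 fg0 => z /= fgz; rewrite !fctE /= fgz fgx.
have dfg := diff_unique cdg Df.
by apply/diff_locallyP; rewrite dfg.
Qed.

Lemma Cm_ext m (U : set V) f g :
  open U -> (forall x, U x -> f x = g x) -> Cm m U g -> Cm m U f.
Proof.
elim: m f g => [|m IHm] f g oU fg /=.
  move=> cg x Ux; have fgx : \near x, f x = g x.
    by apply: filterS (open_nbhs_nbhs (conj oU Ux)) => y /fg.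
  rewrite /prop_for /continuous_at /= (fg x Ux); apply: cvg_trans (cg x Ux).
  by apply: near_eq_cvg; apply: filterS fgx => y.
move=> [dg Cg].
have nfg x : U x -> \near x, f x = g x.
  by move=> Ux; apply: filterS (open_nbhs_nbhs (conj oU Ux)) => y /fg.
split=> [x Ux|u]; first exact: near_eq_differentiable (nfg x Ux) (dg x Ux).
by apply: (IHm _ _ oU _ (Cg u)) => x Ux; apply: near_eq_derive; exact: nfg.
Qed.

End PolynomialFunctions.

Lemma polyfun_coord (R : realType) n (k : 'I_n.+1) :
  polyfun (fun x : 'rV[R]_n.+1 => x 0 k).
Proof.
have lin : GRing.linear_for *%R (fun x : 'rV[R]_n.+1 => x 0 k : R^o).
  by move=> c x y; rewrite !mxE.
pose linB := GRing.isLinear.Build _ _ _ _ _ lin.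
pose l : {linear 'rV[R]_n.+1 -> R^o} :=
  HB.pack (fun x : 'rV[R]_n.+1 => x 0 k : R^o) linB.
apply: (polyfun_lin (f := l)); exact: coord_continuous.
Qed.

Lemma polyfun_id (R : realType) : polyfun (fun s : R^o => s).
Proof. by apply: (polyfun_lin (f := @idfun R^o)) => x. Qed.

(** * The closed quadrilateral contains the hull of its vertices *)

Lemma sum_ord4 (W : nmodType) (F : 'I_4 -> W) :
  \sum_i F i = F 0 + F 1 + F 2 + F 3.
Proof.
rewrite !big_ord_recl big_ord0 addr0 !addrA.
by congr (F _ + F _ + F _ + F _); apply: val_inj.
Qed.

Section Hull.
Variables (R : realType).
Implicit Types (v : 'I_4 -> 'rV[R]_2) (x y a b c : 'rV[R]_2).

Definition coef4 (a b c d : R) (i : 'I_4) : R := nth 0 [:: a; b; c; d] i.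

Lemma mem_vertex_hull v (a b c d : R) :
  0 <= a -> 0 <= b -> 0 <= c -> 0 <= d -> a + b + c + d = 1 ->
  vertex_hull v (a *: v 0 + b *: v 1 + c *: v 2 + d *: v 3).
Proof.
move=> a0 b0 c0 d0 s1; exists (coef4 a b c d); last by rewrite sum_ord4.
split; last by rewrite sum_ord4.
by case=> [[|[|[|[|//]]]]] ?.
Qed.

Lemma vertex_hull_convex v x y (t : R) :
  0 <= t <= 1 -> vertex_hull v x -> vertex_hull v y ->
  vertex_hull v ((1 - t) *: x + t *: y).
Proof.
move=> /andP[t0 t1] [c [c0 c1] ->] [d [d0 d1] ->].
exists (fun i => (1 - t) * c i + t * d i).
  split=> [i|]; first by rewrite addr_ge0 ?mulr_ge0 ?subr_ge0.
  by rewrite big_split /= -!mulr_sumr c1 d1; ring.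
rewrite !scaler_sumr -big_split; apply: eq_bigr => i _.
by rewrite /= !scalerA -scalerDl.
Qed.

Lemma continuous_orient a b : continuous (orient a b).
Proof.
have pc k (r : R) : polyfun (fun y : 'rV[R]_2 => y 0 k + r).
  exact: polyfunD (polyfun_coord R k) (polyfun_cst _ r).
have -> : orient a b = (fun y => (b 0 0 - a 0 0) * (y 0 1 + - a 0 1)
                                 + - (b 0 1 - a 0 1) * (y 0 0 + - a 0 0)).
  by apply/funext => y; rewrite /orient; ring.
move=> y; apply/differentiable_continuous/polyfun_differentiable.
by apply: polyfunD; apply: polyfunM (pc _ _); exact: polyfun_cst.
Qed.

Lemma eq_rV2 x y : x 0 0 = y 0 0 -> x 0 1 = y 0 1 -> x = y.
Proof.
move=> e0 e1; apply/rowP => -[[|[|//]] lt_i].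
- by have -> : Ordinal lt_i = 0 by apply: val_inj.
- by have -> : Ordinal lt_i = 1 by apply: val_inj.
Qed.

(** The barycentric coordinates of a point in a triangle are quotients of
    signed areas. *)
Lemma triangle_sub_vertex_hull v y : 0 < orient (v 0) (v 1) (v 2) ->
  0 < orient (v 0) (v 1) y -> 0 < orient (v 1) (v 2) y ->
  0 < orient (v 2) (v 0) y -> vertex_hull v y.
Proof.
set D := orient _ _ (v 2) => D0 y01 y12 y20.
have -> : y = (orient (v 1) (v 2) y / D) *: v 0 +
              (orient (v 2) (v 0) y / D) *: v 1 +
              (orient (v 0) (v 1) y / D) *: v 2 + 0 *: v 3.
  have := lt0r_neq0 D0; rewrite /D /orient => Dn0.
  by apply: eq_rV2; rewrite !mxE; field.
apply: mem_vertex_hull; rewrite ?divr_ge0 // ?ltW //.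
have := lt0r_neq0 D0; rewrite /D /orient => Dn0; by field.
Qed.

Lemma convex_quad_orient012 v : convex_quad v -> 0 < orient (v 0) (v 1) (v 2).
Proof. by move=> /(_ 0 2); rewrite add0r; apply. Qed.

(** The centroid of three of the vertices is interior to the hull: the three
    signed areas seen from it are positive, and they stay so nearby. *)
Lemma quad_nonempty v : convex_quad v -> quad v !=set0.
Proof.
move=> /convex_quad_orient012 D0.
exists (3^-1 *: v 0 + 3^-1 *: v 1 + 3^-1 *: v 2).
set c := (X in quad v X).
have near_pos a b : 0 < orient a b c -> \forall y \near c, 0 < orient a b y.
  move=> c0; apply: (continuous_orient (lt_nbhsr c0)).
have c01 : 0 < orient (v 0) (v 1) c.
  by move: D0; rewrite /orient /c !mxE; lra.
have c12 : 0 < orient (v 1) (v 2) c.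
  by move: D0; rewrite /orient /c !mxE; lra.
have c20 : 0 < orient (v 2) (v 0) c.
  by move: D0; rewrite /orient /c !mxE; lra.
apply: filterS3 (near_pos _ _ c01) (near_pos _ _ c12) (near_pos _ _ c20).
by move=> y; exact: triangle_sub_vertex_hull.
Qed.

(** Move from a point [x] of the hull towards an interior point [z].  Every
    point [(1 - t) *: x + t *: z] with [0 < t <= 1] is interior, being the image
    of [z] under the homothety of ratio [t] centred at [x], which maps the hull
    into itself; and these points tend to [x] as [t] tends to 0. *)
Lemma vertex_hull_sub_closure_quad v :
  convex_quad v -> vertex_hull v `<=` closure (quad v).
Proof.
move=> /quad_nonempty[z qz] x hx B Bx.
pose g (t : R) := (1 - t) *: x + t *: z.
have g0 : g 0 = x by rewrite /g subr0 scale1r scale0r addr0.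
have cg : {for 0, continuous g}.
  apply: cvgD; apply: cvgZr_tmp => //.
  by apply: cvgB => //; exact: cvg_cst.
have : \forall t \near 0, B (g t) by apply: cg; rewrite g0.
move=> /nbhs_ballP[e /= e0 eB].
pose t := Num.min 1 (e / 2).
have t0 : 0 < t by rewrite lt_min ltr01 divr_gt0.
have t1 : t <= 1 by rewrite ge_min lexx.
exists (g t); split; last first.
  apply: eB; rewrite /ball /= sub0r normrN gtr0_norm // gt_min.
  by apply/orP; right; lra.
(* [h] is the inverse of the homothety. *)
pose h y := t^-1 *: (y - (1 - t) *: x).
have hg : h (g t) = z.
  by rewrite /h /g addrC addKr scalerA mulVf ?scale1r ?gt_eqF.
have ch : {for g t, continuous h}.
  apply: (continuous_comp (f := fun y => y - (1 - t) *: x)).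
    by apply/differentiable_continuous; apply: differentiableB.
  exact: scaler_continuous.
have : \forall y \near g t, vertex_hull v (h y) by apply: ch; rewrite hg.
apply: filterS => y hy.
have -> : y = (1 - t) *: x + t *: h y.
  by rewrite /h scalerA mulfV ?scale1r ?gt_eqF // addrC subrK.
by apply: vertex_hull_convex => //; rewrite (ltW t0).
Qed.

End Hull.

(** * The bilinear parametrization *)

Section Quadrilateral.
Variable R : realType.
Implicit Types (v : 'I_4 -> 'rV[R]_2) (x xi a b m : 'rV[R]_2).
Implicit Types (P T : {poly {poly R}}).

Definition FQ_coef xi : 'I_4 -> R :=
  coef4 ((1 - xi 0 0) * (1 - xi 0 1)) (xi 0 0 * (1 - xi 0 1))
        (xi 0 0 * xi 0 1) ((1 - xi 0 0) * xi 0 1).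

Lemma FQ_coefE v xi : FQ v xi = \sum_i FQ_coef xi i *: v i.
Proof. by rewrite sum_ord4. Qed.

Lemma FQ_coef_ge0 xi i : hatQ xi -> 0 <= FQ_coef xi i.
Proof.
move=> hxi; have /andP[x0 x1] := hxi 0; have /andP[y0 y1] := hxi 1.
by case: i => [[|[|[|[|//]]]]] ?; rewrite /FQ_coef /coef4 /= mulr_ge0 ?subr_ge0.
Qed.

Lemma sum_FQ_coef xi : \sum_i FQ_coef xi i = 1.
Proof. by rewrite sum_ord4 /FQ_coef /coef4 /=; ring. Qed.

Lemma FQ_vertex_hull v xi : hatQ xi -> vertex_hull v (FQ v xi).
Proof.
move=> hxi; exists (FQ_coef xi); last exact: FQ_coefE.
by split=> [i|]; [exact: FQ_coef_ge0|exact: sum_FQ_coef].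
Qed.

Lemma orient_sum (v : 'I_4 -> 'rV[R]_2) a b (c : 'I_4 -> R) : \sum_i c i = 1 ->
  orient a b (\sum_i c i *: v i) = \sum_i c i * orient a b (v i).
Proof.
rewrite !sum_ord4 /orient !mxE => c1.
have -> : c 0 = 1 - c 1 - c 2 - c 3 by rewrite -c1; ring.
by ring.
Qed.

(** On the line through an edge, the signed area with that edge vanishes.  It
    is the combination, with the coefficients [c], of its values at the
    vertices, which are positive at the two vertices off the edge and zero at
    the others. *)
Lemma edge_coef0 v i (c : 'I_4 -> R) : convex_quad v ->
  (forall j, 0 <= c j) -> \sum_j c j = 1 -> edge v i (\sum_j c j *: v j) ->
  forall j, j != i -> j != i + 1 -> c j = 0.
Proof.
move=> hv c0 c1 [t _ xE] j ji ji1.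
have o_ge0 k : 0 <= orient (v i) (v (i + 1)) (v k).
  have [->|ki] := eqVneq k i; first by rewrite /orient; lra.
  have [->|ki1] := eqVneq k (i + 1); first by rewrite /orient; lra.
  exact/ltW/hv.
have : \sum_k c k * orient (v i) (v (i + 1)) (v k) = 0.
  by rewrite -orient_sum // xE /orient !mxE; ring.
move/psumr_eq0P => /(_ (fun k _ => mulr_ge0 (c0 k) (o_ge0 k)) j isT)/eqP.
by rewrite mulf_eq0 (gt_eqF (hv _ _ ji ji1)) orbF => /eqP.
Qed.

(** The coefficients of the two vertices off the i-th edge vanish at [xi], and
    their sum is the distance from [xi] to the i-th side of the unit square.
    On the sides 2 and 3 the edge coordinate runs against the orientation of
    the boundary, whence the exchange of the endpoints. *)
Lemma hat_edge_affine v i : convex_quad v -> exists a b, forall xi,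
  hat_edge v i xi ->
  FQ v xi = (1 - edge_coord i xi) *: a + edge_coord i xi *: b.
Proof.
move=> hv.
exists (if (i < 2)%N then v i else v (i + 1)).
exists (if (i < 2)%N then v (i + 1) else v i) => xi [hxi]; rewrite /= => exi.
have := exi; rewrite [X in edge v i X]FQ_coefE.
move=> /(edge_coef0 hv (fun j => FQ_coef_ge0 j hxi) (sum_FQ_coef xi)).
have v_ord (j k : 'I_4) : val j = val k -> v j = v k by move/val_inj->.
case: i exi => [[|[|[|[|//]]]]] lt_i _ c0; rewrite /edge_coord /=.
- have := c0 2 isT isT; have := c0 3 isT isT; rewrite /FQ_coef /coef4 /= => e3 e2.
  have y0 : xi 0 1 = 0 by lra.
  rewrite (v_ord (Ordinal lt_i) 0) // (v_ord (Ordinal lt_i + 1) 1) //.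
  by rewrite /FQ y0; apply: eq_rV2; rewrite !mxE; ring.
- have := c0 0 isT isT; have := c0 3 isT isT; rewrite /FQ_coef /coef4 /= => e3 e0.
  have x1 : xi 0 0 = 1 by lra.
  rewrite (v_ord (Ordinal lt_i) 1) // (v_ord (Ordinal lt_i + 1) 2) //.
  by rewrite /FQ x1; apply: eq_rV2; rewrite !mxE; ring.
- have := c0 0 isT isT; have := c0 1 isT isT; rewrite /FQ_coef /coef4 /= => e1 e0.
  have y1 : xi 0 1 = 1 by lra.
  rewrite (v_ord (Ordinal lt_i) 2) // (v_ord (Ordinal lt_i + 1) 3) //.
  by rewrite /FQ y1; apply: eq_rV2; rewrite !mxE; ring.
- have := c0 1 isT isT; have := c0 2 isT isT; rewrite /FQ_coef /coef4 /= => e2 e1.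
  have x0 : xi 0 0 = 0 by lra.
  rewrite (v_ord (Ordinal lt_i) 3) // (v_ord (Ordinal lt_i + 1) 0) //.
  by rewrite /FQ x0; apply: eq_rV2; rewrite !mxE; ring.
Qed.

(** A component of the parametrization, as a polynomial. *)
Definition bilinear_poly (a b c d : R) : {poly {poly R}} :=
  (1 - 'X) * (1 - 'X%:P) * a%:P%:P + 'X * (1 - 'X%:P) * b%:P%:P
  + 'X * 'X%:P * c%:P%:P + (1 - 'X) * 'X%:P * d%:P%:P.

Lemma wdeg_le_bilinear_poly s t (a b c d : R) :
  wdeg_le s t (s + t)%N (bilinear_poly a b c d).
Proof.
have dX := @wdeg_leX R s t; have dY := @wdeg_leY R s t.
have d1X : wdeg_le s t s (1 - 'X : {poly {poly R}}).
  by apply: wdeg_leD (wdeg_leN dX); apply: (wdeg_leW (leq0n _)); exact: wdeg_leC.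
have d1Y : wdeg_le s t t (1 - 'X%:P : {poly {poly R}}).
  by apply: wdeg_leD (wdeg_leN dY); apply: (wdeg_leW (leq0n _)); exact: wdeg_leC.
rewrite -[X in wdeg_le _ _ X]addn0.
by rewrite /bilinear_poly; do 3?[apply: wdeg_leD];
  (apply: wdeg_leM; last exact: wdeg_leC); apply: wdeg_leM.
Qed.

Lemma horner_bilinear_poly v xi k :
  (bilinear_poly (v 0 0 k) (v 1 0 k) (v 2 0 k) (v 3 0 k)).[(xi 0 0)%:P].[xi 0 1]
  = FQ v xi 0 k.
Proof. by rewrite /bilinear_poly /FQ !mxE !hornerE. Qed.

(** A component of [(1 - s) *: a + s *: b + t *: m], with [t] as outer and [s] as
    inner variable. *)
Definition edge_poly (a b m : R) : {poly {poly R}} :=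
  (1 - 'X%:P) * a%:P%:P + 'X%:P * b%:P%:P + 'X * m%:P%:P.

Lemma wdeg_le_edge_poly (a b m : R) : wdeg_le 1 1 1 (edge_poly a b m).
Proof.
have d1Y : wdeg_le 1 1 1 (1 - 'X%:P : {poly {poly R}}).
  apply: wdeg_leD (wdeg_leN (@wdeg_leY R 1 1)).
  by apply: (wdeg_leW (leq0n _)); exact: wdeg_leC.
have dX := @wdeg_leX R 1 1; have dY := @wdeg_leY R 1 1.
have dC := @wdeg_leC R 1 1; rewrite -[X in wdeg_le _ _ X]addn0.
rewrite /edge_poly; do 2?[apply: wdeg_leD]; exact: wdeg_leM.
Qed.

Lemma horner_edge_poly a b m (s t : R) k :
  (edge_poly (a 0 k) (b 0 k) (m 0 k)).[t%:P].[s] =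
  ((1 - s) *: a + s *: b + t *: m) 0 k.
Proof. by rewrite /edge_poly !mxE !hornerE. Qed.

(** Subtracting the constant term in [t] and dividing by [t] leaves a polynomial
    [W], so the limit is the value of [W] at [t = 0]. *)
Lemma difference_quotient_cvg T (s : R) :
  t^-1 * (T.[t%:P].[s] - T.[0].[s]) @[t --> (0 : R)^'] --> (T`_1).[s].
Proof.
have [W [c TE]] : exists W c, T = W * 'X + c%:P.
  by elim/poly_ind: T => [|W c _]; [exists 0, 0; rewrite mul0r addr0|exists W, c].
have T1 : T`_1 = W.[0%:P] by rewrite TE coefD coefMX coefC /= addr0 horner_coef0.
have cW : {for 0, continuous (fun t : R => W.[t%:P].[s])}.
  apply/differentiable_continuous.
  apply: (@polyfun_differentiable R R^o).
  apply: polyfun_horner2; last exact: polyfun_cst.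
  exact: polyfun_id.
rewrite T1.
apply: cvg_trans (cvg_trans (cvg_app _ (@nbhs_dnbhs _ _)) cW).
apply: near_eq_cvg; near=> t.
have t0 : t != 0 by near: t; exact: nbhs_dnbhs_neq.
by rewrite TE !hornerE addrK mulrCA mulVf // mulr1.
Unshelve. all: by end_near. Qed.

Lemma size_coef1 p T :
  (0 < p)%N -> wdeg_le 1 1 p T -> (size (T`_1)%R <= p.-1.+1)%N.
Proof.
move=> p0 dT; apply/leq_sizeP => j pj.
by apply/eqP; apply: contraLR pj => /dT; lia.
Qed.

End Quadrilateral.

(** * Polynomials belong to the local space *)

Theorem lemma4p5 (R : realType) (p : nat) (v n : 'I_4 -> 'rV[R]_2)
    (hp : (3 <= p)%N) (hv : convex_quad v)
    (hn : forall i : 'I_4, unit_normal v i (n i)) :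
  poly_space p (closure (quad v)) `<=` local_space p v n.
Proof.
move=> phi [P dP phiE].
have clFQ xi : hatQ xi -> closure (quad v) (FQ v xi).
  by move=> hxi; exact/vertex_hull_sub_closure_quad/FQ_vertex_hull.
have pull : pullback_poly v p phi (@hatQ R).
  pose X k := bilinear_poly (v 0 0 k) (v 1 0 k) (v 2 0 k) (v 3 0 k).
  exists (subst2 P (X 0) (X 1)).
    by apply: wdeg_le_bidegree; rewrite -[X in wdeg_le _ _ X]muln1;
      apply: wdeg_le_subst2 => //; exact: wdeg_le_bilinear_poly.
  move=> xi hxi; rewrite horner_subst2 !horner_bilinear_poly.
  exact/phiE/clFQ.
have normal i : normal_derive_poly v p.-1 phi i (n i) (hat_edge v i).
  have [a [b FQE]] := hat_edge_affine i hv.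
  pose X k := edge_poly (a 0 k) (b 0 k) (n i 0 k).
  pose T := subst2 P (X 0) (X 1).
  exists T`_1.
    apply: size_coef1; first exact: leq_trans hp.
    by rewrite -[p]muln1; apply: wdeg_le_subst2 => //; exact: wdeg_le_edge_poly.
  move=> xi hxi; set s := edge_coord i xi.
  have TE t : closure (quad v) (FQ v xi + t *: n i) ->
      phi (FQ v xi + t *: n i) = T.[t%:P].[s].
    move=> /phiE->.
    by rewrite horner_subst2 !horner_edge_poly FQE.
  have T0 : phi (FQ v xi) = T.[0].[s].
    have := TE 0; rewrite scale0r addr0; apply.
    exact: clFQ hxi.1.
  (* For the increments [t] that stay in the closure, the difference quotients of
     [phi] are those of [T], whose limit is unrestricted. *)
  apply: (cvg_trans _ (@difference_quotient_cvg R T s)).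
  apply: (cvg_trans _ (cvg_app _ (@cvg_within _ _ _ _))).
  apply: near_eq_cvg; rewrite near_withinE; near=> t => /= ht.
  by rewrite TE // T0.
rewrite /local_space; case: ifP => p5; first by split.
split.
- pose g (x : 'rV[R]_2) : R^o := P.[(x 0 0)%:P].[x 0 1].
  apply: (@Cm_ext R 'rV[R]_2 (p - 2)%N (quad v) phi g).
  + exact: open_interior.
  + by move=> x qx; apply: phiE; exact: subset_closure.
  + by apply: polyfun_Cm; apply: polyfun_horner2; exact: polyfun_coord.
- move=> i j; have [P' dP' P'E] := pull; exists P' => // xi [xiP xjP].
  apply: P'E => k.
  have k0 : (0 < 6 - p)%N by lia.
  have bounds (l : 'I_(6 - p)) (z : R) :
      l%:R / (6 - p)%:R <= z <= l.+1%:R / (6 - p)%:R -> 0 <= z <= 1.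
    move=> /andP[lz zl]; apply/andP; split; first exact: le_trans lz.
    apply: le_trans zl _; rewrite ler_pdivrMr ?ltr0n // mul1r ler_nat.
    exact: ltn_ord.
  case: k => [[|[|//]]] lt_k.
  + have -> : Ordinal lt_k = 0 by apply: val_inj.
    exact: bounds xiP.
  + have -> : Ordinal lt_k = 1 by apply: val_inj.
    exact: bounds xjP.
- move=> i; have [a [b FQE]] := hat_edge_affine i hv.
  (* Only sums and products, to match the generators of [polyfun]. *)
  pose l k (s : R^o) : R^o := (1 + (-1) * s) * a 0 k + s * b 0 k.
  have pl k : polyfun (l k).
    have pid := polyfun_id R.
    have pc c := polyfun_cst (R^o) (c : R).
    apply: polyfunD; apply: polyfunM => //.
    apply: polyfunD => //; exact: polyfunM.
  exists (fun s => P.[(l 0 s)%:P].[l 1 s]).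
    exact/polyfun_Cm/polyfun_horner2.
  move=> xi hxi; rewrite phiE; last exact: clFQ hxi.1.
  rewrite (FQE _ hxi) !mxE /l.
  by congr (P.[_%:P].[_]); ring.
- move=> i c d; have [q sq qE] := normal i.
  by exists q => // xi [/qE].
Unshelve. all: by end_near. Qed.
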